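(* There is a computable function $g$ such that the following holds. Let $A \in \mathbb{Z}^{m \times n}$ and let $F$ be a td-decomposition of $G_P(A)$. Let $A_B \in \mathbb{Z}^{m \times m}$ be a submatrix of $A$ formed by a collection of $m$ columns of $A$ which is invertible. Then $\mathrm{fr}(A_B^{-1}) \le g(\mathrm{height}(F), \|A\|_\infty)$.
   Context: The primal graph $G_P(A)$ of a matrix $A$ has one vertex per column of $A$, two columns being adjacent if some row of $A$ has non-zero entries in both columns. For a rooted tree $F$, its closure $\mathrm{cl}(F)$ is the graph obtained from $F$ by making every vertex adjacent to all its ancestors; $\mathrm{height}(F)$ is the maximum number of vertices on a root-leaf path. A td-decomposition of a graph $G$ is a rooted tree $F$ on the vertex set of $G$ such that $G$ is a subgraph of $\mathrm{cl}(F)$. For a rational matrix $M$, $\mathrm{fr}(M)$ (the fractionality of $M$) is the maximum denominator among all entries of $M$ written as fractions in lowest terms. *)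

(* Defs.v *)
From HB Require Import structures.
From mathcomp Require Import all_boot all_order all_algebra.
Set Implicit Arguments. Unset Strict Implicit. Unset Printing Implicit Defensive.
Import Order.TTheory GRing.Theory Num.Theory.
Local Open Scope ring_scope.

Definition primal_graph (m n : nat) (A : 'M[int]_(m, n)) : rel 'I_n :=
  fun i j => (i != j) && [exists r : 'I_m, (A r i != 0) && (A r j != 0)].

(* A rooted tree on vertex set 'I_n is given by its parent function
   p : 'I_n -> option 'I_n (None for the root). *)
Fixpoint up (n : nat) (p : 'I_n -> option 'I_n) (k : nat) (v : 'I_n)
  : option 'I_n :=
  match k with
  | 0 => Some v
  | k'.+1 => if up p k' v is Some w then p w else None
  end.

(* u is a proper ancestor of v (reached by k >= 1 parent steps; in an
   acyclic parent structure on n vertices k <= n suffices). *)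
Definition ancestor (n : nat) (p : 'I_n -> option 'I_n) (u v : 'I_n) : bool :=
  [exists k : 'I_n.+1, (0 < (k : nat))%N && (up p k v == Some u)].

Definition rooted_tree (n : nat) (p : 'I_n -> option 'I_n) : Prop :=
  (forall (k : nat) (v : 'I_n), (0 < k)%N -> up p k v <> Some v) /\
  #|[set v | p v == None]| = 1%N.

Definition closure_edge (n : nat) (p : 'I_n -> option 'I_n) : rel 'I_n :=
  fun u v => ancestor p u v || ancestor p v u.

Definition td_decomposition (n : nat) (G : rel 'I_n)
    (p : 'I_n -> option 'I_n) : Prop :=
  rooted_tree p /\ (forall u v, G u v -> closure_edge p u v).

(* height(F): max number of vertices on a root-leaf path = max over v of
   the number of vertices on the root-v path (v and its ancestors). *)
Definition height (n : nat) (p : 'I_n -> option 'I_n) : nat :=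
  \max_(v : 'I_n) #|[set u | (u == v) || ancestor p u v]|.

Definition mx_norm_inf (m n : nat) (A : 'M[int]_(m, n)) : nat :=
  \max_(i : 'I_m) \max_(j : 'I_n) `|A i j|%N.

Definition fr (m n : nat) (M : 'M[rat]_(m, n)) : nat :=
  \max_(i : 'I_m) \max_(j : 'I_n) `|denq (M i j)|%N.

Definition to_rat (m n : nat) (A : 'M[int]_(m, n)) : 'M[rat]_(m, n) :=
  map_mx (fun z : int => z%:~R) A.

(* Main.v *)
Require Import Defs.
From mathcomp Require Import all_boot all_order all_algebra.
From mathcomp Require Import zify ring.
Set Implicit Arguments. Unset Strict Implicit. Unset Printing Implicit Defensive.
Import GRing.Theory Num.Theory.

(* Padding a column of the inverse basis matrix with zeros gives a rational
   vector y, supported on the basis columns U, such that A y is integral and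
   the rows of A determine every vector supported on U.  It suffices to find
   an integer L, depending only on ||A||_oo and the height, such that L y is
   integral for all such y.  Split U into an arbitrary part S and a part Q,
   on which the ancestor relation induces a forest.  If Q is empty, eliminate
   the columns of S one at a time: each step turns the entry bound a into
   2a^2, and a! is divisible by the pivot.  Otherwise every row meets at most
   one tree of Q, and a dimension count shows that at most |S| trees already
   determine the S-part of y.  Induction on the height applies first to S
   together with these trees, their roots moved into S, which clears y on S,
   and then to every tree alone, with its root as the only arbitrary column. *)

Section ParentFunction.
Variables (n : nat) (p : 'I_n -> option 'I_n).

Lemma up_add a b v : up p (a + b) v = obind (up p a) (up p b v).
Proof.
elim: a => [|a IH]; first by rewrite add0n; case: (up p b v).
by rewrite addSn /= IH; case: (up p b v).
Qed.

Lemma primal_graph_chain m (A : 'M[int]_(m, n)) :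
  td_decomposition (primal_graph A) p -> forall i j j',
  (A i j != 0)%R -> (A i j' != 0)%R -> [|| j == j', ancestor p j j' | ancestor p j' j].
Proof.
move=> [_ sub_cl] i j j' Aij Aij'; case: eqVneq => //= ne_jj'; apply: sub_cl.
by rewrite /primal_graph ne_jj'; apply/existsP; exists i; rewrite Aij Aij'.
Qed.

Hypothesis up_acyclic : forall k v, (0 < k)%N -> up p k v <> Some v.

Lemma up_Some_lt k v u : up p k v = Some u -> (k < n)%N.
Proof.
move=> ukv.
have up_Some i : (i <= k)%N -> exists w, up p i v = Some w.
  move=> le_ik; case E: (up p i v) => [w|]; first by exists w.
  by move: ukv; rewrite -(subnK le_ik) up_add E.
pose f (i : 'I_k.+1) := odflt u (up p i v).
have f_up (i : 'I_k.+1) : up p i v = Some (f i).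
  by have [w E] := up_Some i (ltn_ord i); rewrite /f E.
have up_neq (i j : 'I_k.+1) : (i < j)%N -> up p i v != up p j v.
  move=> lt_ij; rewrite -(subnK (ltnW lt_ij)) up_add f_up /=.
  by apply/eqP => /esym; apply: up_acyclic; rewrite subn_gt0.
have f_inj : injective f.
  move=> i j fij; have up_ij : up p i v = up p j v by rewrite !f_up fij.
  apply/val_inj; case: (ltngtP i j) => // lt; [move: (up_neq i j lt) | move: (up_neq j i lt)];
    by rewrite up_ij eqxx.
by have := leq_card f f_inj; rewrite !card_ord.
Qed.

Lemma ancestorP u v :
  reflect (exists2 k, (0 < k)%N & up p k v = Some u) (ancestor p u v).
Proof.
apply: (iffP existsP) => [[k /andP [k_gt0 /eqP ukv]] | [k k_gt0 ukv]].
  by exists k.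
by exists (Ordinal (ltnW (up_Some_lt ukv) : (k < n.+1)%N)); rewrite /= k_gt0 ukv eqxx.
Qed.

Lemma ancestor_trans u w v : ancestor p u w -> ancestor p w v -> ancestor p u v.
Proof.
move=> /ancestorP [a a_gt0 uwa] /ancestorP [b _ wvb]; apply/ancestorP.
by exists (a + b); [rewrite addn_gt0 a_gt0 | rewrite up_add wvb].
Qed.

Lemma ancestor_irr : irreflexive (ancestor p).
Proof. by move=> v; apply/negbTE/negP => /ancestorP [k k_gt0]; apply: up_acyclic. Qed.

Lemma ancestor_total u w v : ancestor p u v -> ancestor p w v ->
  [|| u == w, ancestor p u w | ancestor p w u].
Proof.
move=> /ancestorP [a a_gt0 uva] /ancestorP [b b_gt0 wvb].
case: (ltngtP a b) => [lt_ab | lt_ba | eq_ab].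
- apply/or3P/Or33/ancestorP; exists (b - a); first by rewrite subn_gt0.
  by move: wvb; rewrite -{1}(subnK (ltnW lt_ab)) up_add uva.
- apply/or3P/Or32/ancestorP; exists (a - b); first by rewrite subn_gt0.
  by move: uva; rewrite -{1}(subnK (ltnW lt_ba)) up_add wvb.
- by move: uva; rewrite eq_ab wvb => -[->]; rewrite eqxx.
Qed.

Lemma ancestors_lt_height (U : {set 'I_n}) v :
  (#|[set u in U | ancestor p u v]| < height p)%N.
Proof.
apply: (leq_trans _ (leq_bigmax (F := fun v => #|[set u | (u == v) || ancestor p u v]|) v)).
apply: proper_card; apply/properP; split.
  by apply/subsetP => u; rewrite !inE => /andP [_ ->]; rewrite orbT.
by exists v; rewrite !inE ?eqxx // ancestor_irr andbF.
Qed.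

End ParentFunction.

Section Forest.
Variables (T : finType) (anc : rel T).

Definition height_at_most (Q : {set T}) (h : nat) :=
  forall j, j \in Q -> (#|[set u in Q | anc u j]| < h)%N.

Lemma height_at_most0 Q : height_at_most Q 0 -> Q = set0.
Proof. by move=> hQ; apply/setP => j; rewrite inE; apply/negP => /hQ. Qed.

Hypothesis anc_trans : forall u w v, anc u w -> anc w v -> anc u v.
Hypothesis anc_irr : irreflexive anc.
Hypothesis anc_total :
  forall u w v, anc u v -> anc w v -> [|| u == w, anc u w | anc w u].

Variable Q : {set T}.

(* The root of the tree of j in the forest induced on Q. *)
Definition topmost (j : T) : T :=
  [arg min_(u < j | (u \in Q) && ((u == j) || anc u j)) #|[set w | anc w u]|].

Lemma topmostP j : j \in Q ->
  [/\ topmost j \in Q, (topmost j == j) || anc (topmost j) j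
    & forall w, w \in Q -> ~~ anc w (topmost j)].
Proof.
move=> Qj; rewrite /topmost; case: arg_minnP => [|t /andP [Qt tj] t_min].
  by rewrite Qj eqxx.
split=> // w Qw; apply/negP => anc_wt.
have anc_wj : anc w j by case/orP: tj => [/eqP <- // | /(anc_trans anc_wt)].
have := t_min w; rewrite Qw anc_wj orbT => /(_ isT); apply/negP; rewrite -ltnNge.
apply: proper_card; apply/properP; split.
  by apply/subsetP => x; rewrite !inE => /anc_trans; apply.
by exists w; rewrite !inE ?anc_wt ?anc_irr.
Qed.

Lemma topmost_eq j t : j \in Q -> t \in Q -> (t == j) || anc t j ->
  (forall w, w \in Q -> ~~ anc w t) -> topmost j = t.
Proof.
move=> Qj Qt tj t_top; have [Qr rj r_top] := topmostP Qj.
have /negP r_t := r_top t Qt; have /negP t_r := t_top _ Qr.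
case/orP: rj => [/eqP rj | anc_rj]; case/orP: tj => [/eqP tj | anc_tj].
- by rewrite rj tj.
- by rewrite rj in r_t.
- by rewrite tj in t_r.
- by case/or3P: (anc_total anc_rj anc_tj) => [/eqP // | /t_r | /r_t].
Qed.

Lemma topmost_anc u j : u \in Q -> j \in Q -> anc u j -> topmost u = topmost j.
Proof.
move=> Qu Qj anc_uj; have [Qr ru r_top] := topmostP Qu.
apply/esym/topmost_eq => //.
by case/orP: ru => [/eqP -> | /anc_trans/(_ anc_uj) ->]; rewrite ?anc_uj orbT.
Qed.

Lemma topmost_comparable j j' : j \in Q -> j' \in Q ->
  [|| j == j', anc j j' | anc j' j] -> topmost j = topmost j'.
Proof.
move=> Qj Qj'; case/or3P => [/eqP -> // | anc_jj' | anc_j'j].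
  exact: topmost_anc.
exact/esym/topmost_anc.
Qed.

Lemma topmost_idem j : j \in Q -> topmost (topmost j) = topmost j.
Proof. by move=> Qj; have [Qr _ r_top] := topmostP Qj; apply: topmost_eq; rewrite ?eqxx. Qed.

Lemma height_at_most_nontop (Q' : {set T}) h : Q' \subset Q ->
  (forall j, j \in Q' -> topmost j != j) ->
  height_at_most Q h.+1 -> height_at_most Q' h.
Proof.
move=> sub_Q' nontop hQ j Q'j; have Qj := subsetP sub_Q' j Q'j.
have [Qr rj _] := topmostP Qj.
have anc_rj : anc (topmost j) j.
  by case/orP: rj => // /eqP rj; move: (nontop j Q'j); rewrite rj eqxx.
have Q'r : topmost j \notin Q'.
  by apply/negP => /nontop; rewrite topmost_idem ?eqxx.
suff : (#|[set u in Q' | anc u j]| < #|[set u in Q | anc u j]|)%N.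
  by move=> lt; apply: leq_trans lt _; rewrite -ltnS; apply: hQ.
apply: proper_card; apply/properP; split.
  by apply/subsetP => u; rewrite !inE => /andP [/(subsetP sub_Q') -> ->].
by exists (topmost j); rewrite !inE ?Qr ?anc_rj // (negbTE Q'r).
Qed.

End Forest.

Local Open Scope ring_scope.

Section Restriction.
Variables (F : fieldType) (n : nat).
Implicit Types (x y : 'rV[F]_n) (X U : {set 'I_n}).

Definition supported y U := forall j, j \notin U -> y 0 j = 0.

Definition restr y U : 'rV[F]_n := \row_j (if j \in U then y 0 j else 0).

Lemma restrE y U j : restr y U 0 j = if j \in U then y 0 j else 0.
Proof. by rewrite mxE. Qed.

Lemma restr_supported y U : supported (restr y U) U.
Proof. by move=> j U'j; rewrite restrE (negbTE U'j). Qed.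

Lemma restr_id y U : supported y U -> restr y U = y.
Proof. by move=> y_supp; apply/rowP => j; rewrite restrE; case: ifPn => // /y_supp. Qed.

Lemma restrU y X U : [disjoint X & U] -> restr y (X :|: U) = restr y X + restr y U.
Proof.
move=> XU; apply/rowP => j; rewrite !mxE inE.
by case: (boolP (j \in X)) => [/(disjointFr XU) -> | _]; rewrite ?addr0 ?add0r.
Qed.

Lemma supportedS y X U : X \subset U -> supported y X -> supported y U.
Proof. by move=> XU y_supp j U'j; apply: y_supp; apply: contra U'j; apply: (subsetP XU). Qed.

Lemma supportedZ t y U : supported y U -> supported (t *: y) U.
Proof. by move=> y_supp j U'j; rewrite mxE y_supp ?mulr0. Qed.

Definition restr_mx X : 'M[F]_n := diag_mx (\row_j (j \in X)%:R).

Lemma mul_restr_mx y X : y *m restr_mx X = restr y X.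
Proof.
rewrite mul_mx_diag; apply/rowP => j; rewrite !mxE.
by case: (j \in X); rewrite ?mulr1 ?mulr0.
Qed.

Lemma rank_restr_mx X : (\rank (restr_mx X) <= #|X|)%N.
Proof.
have -> : restr_mx X = \sum_(j in X) delta_mx j j.
  rewrite /restr_mx diag_mx_sum_delta [RHS]big_mkcond; apply: eq_bigr => j _.
  by rewrite mxE; case: (j \in X); rewrite ?scale1r ?scale0r.
rewrite -sum1_card; elim/big_rec2: _ => [|j k B _ rkB]; first by rewrite mxrank0.
by rewrite (leq_trans (mxrank_add _ _)) // mxrank_delta.
Qed.

Lemma sub_restr_mxP y X : reflect (supported y X) (y <= restr_mx X)%MS.
Proof.
apply: (iffP idP) => [/submxP [D ->] j X'j | y_supp].
  by rewrite mul_restr_mx restrE (negbTE X'j).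
by rewrite -(restr_id y_supp) -mul_restr_mx submxMl.
Qed.

Lemma sub_mul_restr_mxP k (K : 'M[F]_(k, n)) X y :
  (y <= K *m restr_mx X)%MS <-> exists2 u, (u <= K)%MS & y = restr u X.
Proof.
split=> [/submxP [D ->] | [u uK ->]].
  by exists (D *m K); rewrite ?submxMl // mulmxA mul_restr_mx.
by rewrite -mul_restr_mx submxMr.
Qed.

End Restriction.
Arguments restr_mx {F n} X.

Lemma cap_subfamily (F : fieldType) (I : finType) n (Vs : I -> 'M[F]_n) k (V : 'M[F]_n) :
  (\rank V <= k)%N ->
  (forall y : 'rV_n, (y <= V)%MS -> (forall i, (y <= Vs i)%MS) -> y = 0) ->
  exists2 J : {set I}, (#|J| <= k)%N &
    forall y : 'rV_n, (y <= V)%MS -> (forall i, i \in J -> (y <= Vs i)%MS) -> y = 0.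
Proof.
elim: k V => [|k IH] V rkV capV.
  exists set0 => [|y]; first by rewrite cards0.
  by move: rkV; rewrite leqn0 mxrank_eq0 => /eqP ->; rewrite submx0 => /eqP.
have [/forallP V_sub | /forallPn [i V_nsub]] := boolP [forall i, (V <= Vs i)%MS].
  exists set0 => [|y yV _]; first by rewrite cards0.
  by apply: (capV y yV) => i; apply: submx_trans yV (V_sub i).
have rkV' : (\rank (V :&: Vs i)%MS <= k)%N.
  rewrite -ltnS (leq_trans _ rkV) // rank_ltmx // ltmxE capmxSl sub_capmx submx_refl.
  exact: V_nsub.
have [J rkJ capJ] := IH _ rkV' (fun y yV' => capV y (submx_trans yV' (capmxSl _ _))).
exists (i |: J) => [|y yV yJ]; first by rewrite cardsU1 (leq_add (leq_b1 _) rkJ).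
apply: capJ => [|j Jj]; last by apply: yJ; rewrite setU1r.
by rewrite sub_capmx yV yJ ?setU11.
Qed.

Section RowApply.
Variables m n : nat.
Implicit Types (A : 'M[int]_(m, n)) (x y : 'rV[rat]_n) (X U : {set 'I_n}) (W : {set 'I_m}).

Definition row_apply A y i : rat := \sum_j (A i j)%:~R * y 0 j.

Definition determines A W U :=
  forall y, supported y U -> (forall i, i \in W -> row_apply A y i = 0) -> y = 0.

Definition clears_denoms A W U (L : nat) :=
  forall y, supported y U -> (forall i, i \in W -> row_apply A y i \is a Num.int) ->
  forall j, L%:R * y 0 j \is a Num.int.

Lemma row_applyD A x y i : row_apply A (x + y) i = row_apply A x i + row_apply A y i.
Proof. by rewrite /row_apply -big_split; apply: eq_bigr => j _; rewrite mxE mulrDr. Qed.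

Lemma row_applyZ A t y i : row_apply A (t *: y) i = t * row_apply A y i.
Proof. by rewrite /row_apply mulr_sumr; apply: eq_bigr => j _; rewrite mxE mulrCA. Qed.

Lemma row_apply_delta A i j : row_apply A (delta_mx 0 j) i = (A i j)%:~R.
Proof.
rewrite /row_apply (bigD1 j) //= big1 => [|k /negbTE ne_kj]; rewrite mxE ?ne_kj ?mulr0 //.
by rewrite !eqxx mulr1 addr0.
Qed.

Lemma eq_row_apply A x y i :
  (forall j, A i j != 0 -> x 0 j = y 0 j) -> row_apply A x i = row_apply A y i.
Proof.
move=> xy; apply: eq_bigr => j _.
by have [-> | /xy ->] := eqVneq (A i j) 0; rewrite ?mul0r.
Qed.

Lemma row_apply_restr A y X i : (forall j, A i j != 0 -> j \notin X -> y 0 j = 0) ->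
  row_apply A (restr y X) i = row_apply A y i.
Proof.
by move=> y0; apply: eq_row_apply => j nz_ij; rewrite restrE; case: ifPn => // /(y0 j nz_ij).
Qed.

Lemma row_apply_restr0 A y X i : (forall j, j \in X -> A i j = 0) ->
  row_apply A (restr y X) i = 0.
Proof.
move=> A0; rewrite /row_apply big1 // => j _; rewrite restrE.
by case: (boolP (j \in X)) => [/A0 -> | _]; rewrite ?mul0r ?mulr0.
Qed.

Lemma row_apply_int A y i : (forall j, y 0 j \is a Num.int) -> row_apply A y i \is a Num.int.
Proof. by move=> y_int; apply: rpred_sum => j _; rewrite rpredM ?intr_int. Qed.

Lemma determinesS A W X U : X \subset U -> determines A W U -> determines A W X.
Proof. by move=> XU detU y /(supportedS XU); apply: detU. Qed.

Lemma pivot_exists A W U j : determines A W U -> j \in U -> exists2 i, i \in W & A i j != 0.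
Proof.
move=> detU Uj; apply/exists_inP; apply: contraT => /exists_inPn col0.
suff /rowP/(_ j)/eqP : delta_mx 0 j = 0 :> 'rV[rat]_n by rewrite !mxE !eqxx oner_eq0.
apply: detU => [k U'k | i Wi].
  by rewrite mxE; case: (eqVneq k j) => [kj | _]; [rewrite kj Uj in U'k | rewrite andbF].
by rewrite row_apply_delta; move: (col0 i Wi); rewrite negbK => /eqP ->.
Qed.

End RowApply.

Section PivotElimination.
Variables (m n : nat) (A : 'M[int]_(m, n)) (i0 : 'I_m) (j0 : 'I_n).

Definition pivot_elim : 'M[int]_(m, n) :=
  \matrix_(i, j) (A i0 j0 * A i j - A i j0 * A i0 j).

Lemma pivot_elim_col i : pivot_elim i j0 = 0.
Proof. by rewrite mxE mulrC subrr. Qed.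

Lemma row_apply_pivot_elim y i : row_apply pivot_elim y i =
  (A i0 j0)%:~R * row_apply A y i - (A i j0)%:~R * row_apply A y i0.
Proof.
rewrite /row_apply !mulr_sumr -sumrB; apply: eq_bigr => j _.
by rewrite mxE intrB !intrM; ring.
Qed.

Lemma pivot_elim_norm a : (forall i j, `|A i j| <= a)%N ->
  forall i j, (`|pivot_elim i j| <= a * a + a * a)%N.
Proof.
move=> normA i j; rewrite mxE.
by have := normA i j; have := normA i j0; have := normA i0 j; have := normA i0 j0; nia.
Qed.

Lemma determines_pivot_elim W (U : {set 'I_n}) : j0 \in U -> A i0 j0 != 0 ->
  determines A W U -> determines pivot_elim W (U :\ j0).
Proof.
move=> Uj0 nz_c detU z z_supp z_rows.
have nz_c' : (A i0 j0)%:~R != 0 :> rat by rewrite intr_eq0.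
pose y := z + (- row_apply A z i0 / (A i0 j0)%:~R) *: delta_mx 0 j0.
have y_i0 : row_apply A y i0 = 0 by rewrite row_applyD row_applyZ row_apply_delta divfK // addrN.
have y_rows i : i \in W -> row_apply A y i = 0.
  move=> Wi; have : row_apply pivot_elim y i = row_apply pivot_elim z i.
    apply: eq_row_apply => j nz; rewrite !mxE; case: (eqVneq j j0) => [jj0 | _].
      by rewrite jj0 pivot_elim_col eqxx in nz.
    by rewrite andbF mulr0 addr0.
  rewrite row_apply_pivot_elim y_i0 mulr0 subr0 z_rows // => /eqP.
  by rewrite mulf_eq0 (negbTE nz_c') => /eqP.
have y_supp : supported y U.
  move=> j U'j; rewrite !mxE z_supp ?inE ?(negbTE U'j) ?andbF // add0r.
  by case: (eqVneq j j0) => [jj0 | _]; [rewrite jj0 Uj0 in U'j | rewrite andbF mulr0].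
have /rowP y0 := detU y y_supp y_rows.
apply/rowP => j; have [-> | ne_jj0] := eqVneq j j0; first by rewrite mxE z_supp // !inE eqxx.
by move: (y0 j); rewrite !mxE (negbTE ne_jj0) andbF mulr0 addr0.
Qed.

End PivotElimination.

Lemma restr_setD1 n (y : 'rV[rat]_n) (U : {set 'I_n}) j : supported y U ->
  y = restr y (U :\ j) + y 0 j *: delta_mx 0 j.
Proof.
move=> y_supp; apply/rowP => k; rewrite !mxE !inE.
case: (eqVneq k j) => [-> | _]; first by rewrite !eqxx mulr1 add0r.
by rewrite mulr0 addr0; case: ifPn => // /y_supp.
Qed.

Lemma dvdz_fact (c : int) (a : nat) : c != 0 -> (`|c| <= a)%N -> (c %| (a`!)%:Z)%Z.
Proof. by move=> nz_c le_ca; rewrite dvdzE dvdn_fact // absz_gt0 nz_c. Qed.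

Lemma int_mul_dvd (c : int) (N : nat) (x : rat) :
  (c %| N%:Z)%Z -> c%:~R * x \is a Num.int -> N%:R * x \is a Num.int.
Proof.
case/dvdzP => q Nqc cx_int.
have -> : N%:R = q%:~R * c%:~R :> rat by rewrite -intrM -Nqc.
by rewrite -mulrA rpredM ?intr_int.
Qed.

Fixpoint elim_bound (s a : nat) : nat :=
  if s is s'.+1 then (a`! * elim_bound s' (a * a + a * a))%N else 1%N.

Lemma elim_bound_gt0 s a : (0 < elim_bound s a)%N.
Proof. by elim: s a => [|s IH] a //=; rewrite muln_gt0 fact_gt0 IH. Qed.

Lemma clears_small_support s : forall a m n (A : 'M[int]_(m, n)) W (U : {set 'I_n}),
  (forall i j, `|A i j| <= a)%N -> (#|U| <= s)%N -> determines A W U ->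
  clears_denoms A W U (elim_bound s a).
Proof.
elim: s => [|s IH] a m n A W U normA U_le detU y y_supp y_rows j.
  by move: U_le; rewrite leqn0 cards_eq0 => /eqP U0; rewrite y_supp ?U0 ?inE ?mulr0.
have [U0 | [j0 Uj0]] := set_0Vmem U; first by rewrite y_supp ?U0 ?inE ?mulr0.
have [i0 Wi0 nz_c] := pivot_exists detU Uj0.
pose L := elim_bound s (a * a + a * a); pose z := restr y (U :\ j0).
have Lz k : L%:R * z 0 k \is a Num.int.
  have U'_le : (#|U :\ j0| <= s)%N by move: U_le; rewrite (cardsD1 j0) Uj0.
  have z_supp : supported z (U :\ j0) by exact: restr_supported.
  apply: (IH _ _ _ _ _ _ (pivot_elim_norm i0 j0 normA) U'_le
    (determines_pivot_elim Uj0 nz_c detU) z z_supp) => i Wi; rewrite row_apply_restr => [|k' nz].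
    by rewrite row_apply_pivot_elim rpredB ?rpredM ?intr_int ?y_rows.
  rewrite !inE negb_and negbK => /orP [/eqP kj0 | /y_supp //].
  by rewrite kj0 pivot_elim_col eqxx in nz.
rewrite /= -/L natrM -mulrA; have [-> | ne_jj0] := eqVneq j j0; last first.
  have -> : y 0 j = z 0 j by rewrite restrE !inE ne_jj0; case: ifPn => // /y_supp.
  by rewrite rpredM ?natr_int.
apply: (int_mul_dvd (dvdz_fact nz_c (normA i0 j0))).
have -> : (A i0 j0)%:~R * (L%:R * y 0 j0) = L%:R * row_apply A y i0 - row_apply A (L%:R *: z) i0.
  by rewrite {2}(restr_setD1 j0 y_supp) row_applyD !row_applyZ row_apply_delta; ring.
by rewrite rpredB ?rpredM ?natr_int ?y_rows // row_apply_int // => k; rewrite mxE.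
Qed.

Section Constraints.
Variables (m n : nat) (A : 'M[int]_(m, n)).

Definition constraint_mx (Y : {set 'I_n}) (Z : {set 'I_m}) : 'M[rat]_(n, n + m) :=
  row_mx (1%:M - restr_mx Y) ((to_rat A)^T *m restr_mx Z).

Lemma row_apply_mul (y : 'rV[rat]_n) i : (y *m (to_rat A)^T) 0 i = row_apply A y i.
Proof. by rewrite mxE; apply: eq_bigr => j _; rewrite !mxE mulrC. Qed.

Lemma kermx_constraintP Y (Z : {set 'I_m}) (u : 'rV[rat]_n) :
  reflect (supported u Y /\ forall i, i \in Z -> row_apply A u i = 0)
          (u <= kermx (constraint_mx Y Z))%MS.
Proof.
rewrite sub_kermx mul_mx_row row_mx_eq0 mulmxBr mulmx1 mul_restr_mx subr_eq0.
rewrite mulmxA mul_restr_mx.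
apply: (iffP andP) => [[/eqP uY /eqP uZ] | [u_supp u_rows]]; split.
- by move=> j Y'j; rewrite uY restrE (negbTE Y'j).
- by move=> i Zi; move/rowP/(_ i): uZ; rewrite restrE Zi row_apply_mul mxE.
- by rewrite restr_id.
- by apply/eqP/rowP => i; rewrite restrE row_apply_mul mxE; case: ifP => // /u_rows.
Qed.

End Constraints.

Fixpoint tree_bound (a s h : nat) : nat :=
  if h is h'.+1 then (tree_bound a (s + s) h' * tree_bound a 1 h')%N
  else elim_bound s a.

Lemma tree_bound_gt0 a s h : (0 < tree_bound a s h)%N.
Proof. by elim: h s => [|h IH] s /=; rewrite ?elim_bound_gt0 ?muln_gt0 ?IH. Qed.

Section ForestElimination.
Variables (m n : nat) (A : 'M[int]_(m, n)) (a : nat) (anc : rel 'I_n).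
Hypothesis normA : forall i j, (`|A i j| <= a)%N.
Hypothesis anc_trans : forall u w v, anc u w -> anc w v -> anc u v.
Hypothesis anc_irr : irreflexive anc.
Hypothesis anc_total :
  forall u w v, anc u v -> anc w v -> [|| u == w, anc u w | anc w u].
Hypothesis row_chain :
  forall i j j', A i j != 0 -> A i j' != 0 -> [|| j == j', anc j j' | anc j' j].

Definition clears_at_height h := forall s (S Q : {set 'I_n}) (W : {set 'I_m}),
  [disjoint S & Q] -> (#|S| <= s)%N -> height_at_most anc Q h ->
  determines A W (S :|: Q) -> clears_denoms A W (S :|: Q) (tree_bound a s h).

Section Trees.
Variables (S Q : {set 'I_n}) (W : {set 'I_m}).
Hypothesis SQ : [disjoint S & Q].
Hypothesis detSQ : determines A W (S :|: Q).

Implicit Types (R J : {set 'I_n}) (r : 'I_n).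

Local Notation top := (topmost anc Q).

Definition trees (R : {set 'I_n}) := [set j in Q | top j \in R].

Definition tree_rows (R : {set 'I_n}) :=
  [set i in W | [forall j in Q, (A i j != 0) ==> (top j \in R)]].

Lemma in_trees R j : (j \in trees R) = (j \in Q) && (top j \in R).
Proof. by rewrite inE. Qed.

Lemma trees_sub R : trees R \subset Q.
Proof. by apply/subsetP => j; rewrite in_trees => /andP []. Qed.

Lemma tree_rowsW R : tree_rows R \subset W.
Proof. by apply/subsetP => i; rewrite inE => /andP []. Qed.

Lemma tree_rowsS R R' : R \subset R' -> tree_rows R \subset tree_rows R'.
Proof.
move=> RR'; apply/subsetP => i; rewrite !inE => /andP [-> /forall_inP Ri] /=.
by apply/forall_inP => j Qj; apply/implyP => /(implyP (Ri j Qj)) /(subsetP RR').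
Qed.

Lemma top_row i j j' : j \in Q -> j' \in Q -> A i j != 0 -> A i j' != 0 -> top j = top j'.
Proof. by move=> Qj Qj' nz nz'; apply: topmost_comparable => //; apply: row_chain nz nz'. Qed.

Lemma tree_rows_cover (r0 : 'I_n) i : i \in W -> exists r, i \in tree_rows [set r].
Proof.
move=> Wi; have [/exists_inP [j1 Qj1 nz1] | /exists_inPn row0] := boolP [exists j in Q, A i j != 0].
  exists (top j1); rewrite inE Wi; apply/forall_inP => j Qj; apply/implyP => nz.
  by rewrite (top_row Qj Qj1 nz nz1) set11.
by exists r0; rewrite inE Wi; apply/forall_inP => j Qj; rewrite (negbTE (row0 j Qj)).
Qed.

Lemma tree_rowsN i R : i \in W -> i \notin tree_rows R -> forall j, j \in trees R -> A i j = 0.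
Proof.
rewrite inE => -> /forall_inPn [j1 Qj1]; rewrite negb_imply => /andP [nz1 R'j1] j.
rewrite in_trees => /andP [Qj Rj]; apply/eqP; apply: contraNT R'j1 => nz.
by rewrite -(top_row Qj Qj1 nz nz1).
Qed.

Lemma row_apply_tree_rows x R i : supported x (S :|: Q) -> i \in tree_rows R ->
  row_apply A (restr x (S :|: trees R)) i = row_apply A x i.
Proof.
move=> x_supp; rewrite inE => /andP [_ /forall_inP Ri]; apply: row_apply_restr => j nz.
rewrite !inE negb_or negb_and => /andP [S'j].
case: (boolP (j \in Q)) => [Qj | Q'j] /=; first by rewrite (implyP (Ri j Qj) nz).
by move=> _; apply: x_supp; rewrite inE negb_or S'j.
Qed.

Definition tree_solutions r : 'M[rat]_n :=
  kermx (constraint_mx A (S :|: trees [set r]) (tree_rows [set r])).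

Definition tree_trace r : 'M[rat]_n := tree_solutions r *m restr_mx S.

Lemma tree_traces_cap (y0 : 'rV[rat]_n) : (y0 <= restr_mx S)%MS ->
  (forall r, (y0 <= tree_trace r)%MS) -> y0 = 0.
Proof.
move=> /sub_restr_mxP y0_supp y0_traces; apply/rowP => j0; rewrite mxE.
have /fin_all_exists [u u_spec] r : exists u, (u <= tree_solutions r)%MS /\ y0 = restr u S.
  by have /sub_mul_restr_mxP [u] := y0_traces r; exists u.
have u_ker r := elimT (kermx_constraintP A _ _ _) (u_spec r).1.
(* A row of W meets at most one tree, so gluing y0 with the tree parts of the
   u r gives a vector on S :|: Q that vanishes on W. *)
pose x := y0 + \sum_r restr (u r) (trees [set r]).
have xE j : x 0 j = y0 0 j + (if j \in Q then u (top j) 0 j else 0).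
  rewrite !mxE summxE; congr (_ + _); case: ifPn => [Qj | Q'j].
    rewrite (bigD1 (top j)) //= big1 => [|r ne_r]; rewrite restrE in_trees ?Qj ?set11 ?addr0 //.
    by rewrite inE eq_sym (negbTE ne_r).
  by rewrite big1 // => r _; rewrite restrE in_trees (negbTE Q'j).
have x0 : x = 0.
  apply: detSQ => [j | i Wi].
    by rewrite inE negb_or xE => /andP [S'j /negbTE ->]; rewrite y0_supp // addr0.
  have [r Ri] := tree_rows_cover j0 Wi.
  rewrite -((u_ker r).2 i Ri); apply: eq_row_apply => j nz; rewrite xE (u_spec r).2 restrE.
  case: (boolP (j \in Q)) => [Qj | Q'j].
    rewrite (disjointFl SQ Qj) add0r; move: Ri; rewrite inE => /andP [_ /forall_inP Ri].
    by move: (implyP (Ri j Qj) nz); rewrite inE => /eqP ->.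
  rewrite addr0; case: ifPn => // S'j; rewrite (u_ker r).1 // !inE negb_or S'j.
  by rewrite (negbTE Q'j).
case: (boolP (j0 \in Q)) => [Qj0 | Q'j0]; first by rewrite y0_supp // (disjointFl SQ Qj0).
by move/rowP/(_ j0): x0; rewrite xE (negbTE Q'j0) addr0 mxE.
Qed.

Lemma determines_selected J :
  (forall y0 : 'rV[rat]_n, (y0 <= restr_mx S)%MS ->
     (forall r, r \in J -> (y0 <= tree_trace r)%MS) -> y0 = 0) ->
  determines A (tree_rows J) (S :|: trees J).
Proof.
move=> capJ x x_supp x_rows.
have x_supp' : supported x (S :|: Q) := supportedS (setUS S (trees_sub J)) x_supp.
have xS : restr x S = 0.
  apply: capJ => [|r Jr]; first exact/sub_restr_mxP/restr_supported.
  apply/sub_mul_restr_mxP; exists (restr x (S :|: trees [set r])); last first.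
    by apply/rowP => j; rewrite !restrE inE; case: (j \in S).
  apply/kermx_constraintP; split => [|i Ri]; first exact: restr_supported.
  rewrite row_apply_tree_rows // x_rows //.
  by apply: subsetP Ri; apply: tree_rowsS; rewrite sub1set.
have xT r : r \in J -> restr x (trees [set r]) = 0.
  move=> Jr; apply: detSQ => [j SQ'j | i Wi].
    apply: restr_supported; apply: contra SQ'j => Tj.
    by rewrite inE (subsetP (trees_sub _) j Tj) orbT.
  case: (boolP (i \in tree_rows [set r])) => Ri; last first.
    by apply: row_apply_restr0 => j; apply: tree_rowsN.
  have STr : [disjoint S & trees [set r]] := disjointWr (trees_sub _) SQ.
  rewrite -[restr x _]add0r -xS -restrU // row_apply_tree_rows // x_rows //.
  by apply: subsetP Ri; apply: tree_rowsS; rewrite sub1set.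
apply/rowP => j; rewrite mxE; case: (boolP (j \in S)) => Sj.
  by move/rowP/(_ j): xS; rewrite restrE Sj mxE.
case: (boolP (j \in trees J)) => [TJj | T'j]; last by rewrite x_supp // inE negb_or Sj.
move: TJj; rewrite in_trees => /andP [Qj Jtop].
by move/rowP/(_ j): (xT _ Jtop); rewrite restrE in_trees Qj set11 mxE.
Qed.

Lemma selected_trees :
  exists2 J : {set 'I_n}, (#|J| <= #|S|)%N & determines A (tree_rows J) (S :|: trees J).
Proof.
have [J J_le capJ] := cap_subfamily (rank_restr_mx _ S) tree_traces_cap.
by exists J => //; apply: determines_selected.
Qed.

Lemma row_apply_trees_int (L : nat) R y :
  supported y (S :|: Q) -> (forall i, i \in W -> row_apply A y i \is a Num.int) ->
  (forall j, j \in S -> L%:R * y 0 j \is a Num.int) ->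
  forall i, i \in W -> row_apply A (L%:R *: restr y (trees R)) i \is a Num.int.
Proof.
move=> y_supp y_rows Ly i Wi; rewrite row_applyZ.
case: (boolP (i \in tree_rows R)) => Ri; last first.
  by rewrite row_apply_restr0 ?mulr0 ?rpred0 // => j; apply: tree_rowsN.
have STR : [disjoint S & trees R] := disjointWr (trees_sub R) SQ.
rewrite -[row_apply A (restr y _) i](addKr (row_apply A (restr y S) i)) -row_applyD -restrU //.
rewrite row_apply_tree_rows // mulrDr mulrN -[_ * row_apply A (restr y S) i]row_applyZ.
rewrite rpredD ?rpredN ?rpredM ?natr_int ?y_rows //.
by apply: row_apply_int => j; rewrite mxE restrE; case: ifP => [/Ly | _]; rewrite ?mulr0 ?rpred0.
Qed.

Variable h : nat.
Hypothesis IH : clears_at_height h.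
Hypothesis hQ : height_at_most anc Q h.+1.

Lemma clears_selected s J : (#|S| <= s)%N -> (#|J| <= s)%N ->
  determines A (tree_rows J) (S :|: trees J) ->
  clears_denoms A (tree_rows J) (S :|: trees J) (tree_bound a (s + s) h).
Proof.
move=> S_le J_le detJ.
pose S' := S :|: [set r in trees J | top r == r].
pose Q' := [set j in trees J | top j != j].
have SQ' : S :|: trees J = S' :|: Q'.
  by apply/setP => j; rewrite !inE; case: (top j == j); rewrite ?andbT ?andbF ?orbF.
rewrite SQ' in detJ *; apply: IH => //.
- rewrite -setI_eq0; apply/eqP/setP => j; rewrite !inE.
  case: (boolP (j \in S)) => [Sj | _]; first by rewrite (disjointFr SQ Sj).
  by case: (top j == j); rewrite ?andbF.
- rewrite cardsU (leq_trans (leq_subr _ _)) // leq_add //.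
  apply: leq_trans J_le; apply: subset_leq_card; apply/subsetP => r.
  by rewrite !inE => /andP [/andP [_ Jr] /eqP <-].
- apply: height_at_most_nontop hQ => // [|j]; last by rewrite inE => /andP [].
  by apply/subsetP => j; rewrite !inE => /andP [/andP [-> _] _].
Qed.

Lemma clears_tree r : r \in Q -> top r = r ->
  clears_denoms A W (trees [set r]) (tree_bound a 1 h).
Proof.
move=> Qr top_r; have Tr : r \in trees [set r] by rewrite in_trees Qr top_r set11.
have detT : determines A W (trees [set r]).
  by apply: determinesS detSQ; apply: subset_trans (trees_sub _) (subsetUr _ _).
rewrite -(setD1K Tr) in detT *; apply: IH => //; first by rewrite disjoints1 setD11.
  by rewrite cards1.
apply: height_at_most_nontop hQ => // [|j].
  by apply: subset_trans (subsetDl _ _) (trees_sub _).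
by rewrite !inE => /andP [ne_jr /andP [_ /eqP ->]]; rewrite eq_sym.
Qed.

Lemma clears_step s : (#|S| <= s)%N -> clears_denoms A W (S :|: Q) (tree_bound a s h.+1).
Proof.
move=> S_le y y_supp y_rows j0.
have [J J_le detJ] := selected_trees.
pose L1 := tree_bound a (s + s) h; pose L2 := tree_bound a 1 h.
have L1y j : j \in S :|: trees J -> L1%:R * y 0 j \is a Num.int.
  have y'_supp : supported (restr y (S :|: trees J)) (S :|: trees J) by exact: restr_supported.
  move=> SJj; have -> : y 0 j = restr y (S :|: trees J) 0 j by rewrite restrE SJj.
  apply: (clears_selected S_le (leq_trans J_le S_le) detJ y'_supp) => i Ri.
  by rewrite row_apply_tree_rows // y_rows // (subsetP (tree_rowsW J)).
rewrite /= -/L1 -/L2 natrM (mulrC L1%:R) -mulrA.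
case: (boolP (j0 \in Q)) => [Qj0 | Q'j0]; last first.
  case: (boolP (j0 \in S)) => [Sj0 | S'j0]; first by rewrite rpredM ?natr_int ?L1y // inE Sj0.
  by rewrite y_supp ?mulr0 ?rpred0 // inE negb_or S'j0.
have [Qr _ _] := topmostP anc_trans anc_irr Qj0.
have v_supp : supported (L1%:R *: restr y (trees [set top j0])) (trees [set top j0]).
  exact/supportedZ/restr_supported.
have L1S j : j \in S -> L1%:R * y 0 j \is a Num.int by move=> Sj; rewrite L1y // inE Sj.
have top_idem : top (top j0) = top j0 by apply: topmost_idem.
move: (clears_tree Qr top_idem v_supp (row_apply_trees_int _ y_supp y_rows L1S) j0).
by rewrite mxE restrE in_trees Qj0 set11.
Qed.

End Trees.

Lemma clears_forest h : clears_at_height h.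
Proof.
elim: h => [|h IH] s S Q W SQ S_le hQ detSQ.
  by move: detSQ; rewrite (height_at_most0 hQ) setU0; apply: clears_small_support.
exact: clears_step.
Qed.

End ForestElimination.

Section ColumnSelection.
Variables (m n : nat) (s : 'I_m -> 'I_n).

Definition lift_col (v : 'cV[rat]_m) : 'rV[rat]_n := \row_j \sum_(i | s i == j) v i 0.

Lemma lift_colE v i : injective s -> lift_col v 0 (s i) = v i 0.
Proof. by move=> s_inj; rewrite mxE (big_pred1 i) // => i'; rewrite /= (inj_eq s_inj). Qed.

Lemma lift_col_supported v : supported (lift_col v) (s @: setT).
Proof.
move=> j j_nim; rewrite mxE big_pred0 // => i; apply: contraNF j_nim => /eqP <-.
by rewrite imset_f ?inE.
Qed.

Lemma row_apply_lift_col (A : 'M[int]_(m, n)) v l :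
  row_apply A (lift_col v) l = (to_rat (colsub s A) *m v) l 0.
Proof.
rewrite [RHS]mxE (partition_big s predT) //=; apply: eq_bigr => j _.
by rewrite mxE mulr_sumr; apply: eq_bigr => i /eqP <-; rewrite !mxE.
Qed.

Lemma determines_basis (A : 'M[int]_(m, n)) : injective s ->
  to_rat (colsub s A) \in unitmx -> determines A setT (s @: setT).
Proof.
move=> s_inj B_unit y y_supp y_rows.
pose z : 'cV[rat]_m := \col_i y 0 (s i).
have y_lift : y = lift_col z.
  apply/rowP => j; case: (boolP (j \in s @: setT)) => [/imsetP [i _ ->] | j_nim].
    by rewrite lift_colE // mxE.
  by rewrite y_supp // lift_col_supported.
have Bz : to_rat (colsub s A) *m z = 0.
  by apply/colP => l; rewrite -row_apply_lift_col -y_lift y_rows ?inE // mxE.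
have z0 : z = 0 by rewrite -(mulKmx B_unit z) Bz mulmx0.
by apply/rowP => j; rewrite y_lift z0 !mxE big1 // => i _; rewrite mxE.
Qed.

End ColumnSelection.

Lemma mx_norm_inf_ge m n (A : 'M[int]_(m, n)) i j : (`|A i j| <= mx_norm_inf A)%N.
Proof.
apply: leq_trans (leq_bigmax (F := fun j => `|A i j|%N) j) _.
exact: (leq_bigmax (F := fun i => \max_j `|A i j|%N)).
Qed.

Lemma denq_le (L : nat) (q : rat) : (0 < L)%N -> L%:R * q \is a Num.int ->
  (`|denq q| <= L)%N.
Proof.
move=> L_gt0 /intrP [z Lqz].
have Lnum : (L%:Z * numq q = z * denq q)%R.
  by apply: (@intr_inj rat); rewrite !intrM numqE mulrA -Lqz.
have : (`|denq q| %| `|numq q| * L)%N.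
  by move/(congr1 absz): Lnum; rewrite !abszM /= mulnC => ->; rewrite dvdn_mull.
rewrite Gauss_dvdr; last by rewrite coprime_sym coprime_num_den.
exact: dvdn_leq.
Qed.

Theorem theorem2 :
  { g : nat -> nat -> nat |
    forall (m n : nat) (A : 'M[int]_(m, n)) (p : 'I_n -> option 'I_n),
      td_decomposition (primal_graph A) p ->
      forall s : 'I_m -> 'I_n, injective s ->
        to_rat (colsub s A) \in unitmx ->
        (fr (invmx (to_rat (colsub s A))) <= g (height p) (mx_norm_inf A))%N }.
Proof.
exists (fun d a => tree_bound a 0 d).
move=> m n A p td s s_inj B_unit; have [[acyclic _] _] := td.
set B := to_rat (colsub s A).
have clears := clears_forest (mx_norm_inf_ge A) (ancestor_trans acyclic)
  (ancestor_irr acyclic) (ancestor_total acyclic) (primal_graph_chain td).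
apply/bigmax_leqP => i _; apply/bigmax_leqP => k _.
apply: denq_le (tree_bound_gt0 _ _ _) _.
have -> : invmx B i k = lift_col s (col k (invmx B)) 0 (s i) by rewrite lift_colE // mxE.
have := clears (height p) 0 set0 (s @: setT) setT.
rewrite set0U; apply => //.
- by rewrite -setI_eq0 set0I.
- by rewrite cards0.
- by move=> j _; apply: ancestors_lt_height.
- exact: determines_basis.
- exact: lift_col_supported.
- by move=> l _; rewrite row_apply_lift_col colE mulmxA mulmxV // mul1mx mxE natr_int.
Qed.
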